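(* Let $G$ and $G'$ be graphs. Suppose that: (a1) $\Delta G\ge 1$ and $G\in\mathcal{CG}_{\bowtie}$; (a2) $\Delta(G\setminus x)\ge 1$ and $G\setminus x\in\mathcal{CG}_{\bowtie}$ for every vertex $x$ in $G$ except for one vertex $v$; (a3) if $p$ is a loop in $G$, then $p$ is incident to $v$; (a4) $v$ is not a $1$-big vertex of $G$ (i.e. $s(v,G)\le\rho^*_1(G)+1$) and $G\setminus v$ has no tree component; and (a5) $M_1(G')=M_1(G)$. Then $\mathcal{S}(G)=\mathcal{S}(G')$, i.e. $G$ and $G'$ are strongly isomorphic.
   Context: Graphs are finite and may have loops and parallel edges. For $X\subseteq E(G)$, $G\langle X\rangle$ is the subgraph of $G$ induced by $X$, i.e. with edge set $X$ and whose vertices are the end-vertices of edges in $X$. $\Delta G=|E(G)|-|V(G)|$. $\mathcal{G}_{\bowtie}$ is the set of graphs having no isolated vertices, no leaves (vertices of degree 1, a loop contributing 2 to the degree), and no cycle components (components that are cycles; a vertex with a single loop is a cycle, and two parallel edges form a cycle). $\mathcal{CG}_{\bowtie}$ is the set of connected graphs in $\mathcal{G}_{\bowtie}$. $M_1(G)$ is the ($1$-circular, i.e. bicircular) matroid on $E(G)$ whose circuits are the sets $C\subseteq E(G)$ with $\Delta G\langle C\rangle=1$ and $G\langle C\rangle\in\mathcal{G}_{\bowtie}$ (these are known to be the circuits of a matroid). $\rho^*_1(G)$ is the corank of $M_1(G)$, i.e. $|E(G)|$ minus the rank of $M_1(G)$. Equality $M_1(G)=M_1(G')$ means equality of ground sets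 $E(G)=E(G')$ and of the families of circuits. $G\setminus x$ is $G$ with vertex $x$ and all edges incident to it deleted. A tree component is a component that is a tree; an isolated vertex counts as a tree. $S(x,G)$ is the set of edges of $G$ incident to $x$ (loops included), $s(x,G)=|S(x,G)|$, and $\mathcal{S}(G)=\{S(x,G):x\in V(G)\}$. A vertex $x$ of $G$ is $1$-big if $s(x,G)>\rho^*_1(G)+1$. Graphs $G=(V,E,\phi)$ and $G'=(V',E,\phi')$ with the same edge set are strongly isomorphic if there is a bijection $\nu:V\to V'$ such that for each edge $e$: $\phi(e)=\{x,y\}\Leftrightarrow\phi'(e)=\{\nu(x),\nu(y)\}$, where $\phi(e)$ is the set of end-vertices of $e$.
   Formalization: The formal theorem additionally assumes that G' has no isolated vertices; without this the claim fails, e.g. for G = K5 and G' = K5 plus an isolated vertex, since isolated vertices do not affect M_1(G') but add the empty set to S(G'). *)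

(* Defs.v *)
From HB Require Import structures.
From mathcomp Require Import all_boot all_order all_algebra.

Set Implicit Arguments.
Unset Strict Implicit.
Unset Printing Implicit Defensive.

(* Finite graphs with loops and parallel edges, whose vertices and edges are   *)
(* taken from ambient finite types T and E, so that subgraphs of a graph have  *)
(* the same type as the graph itself. An edge is a loop when it has a single   *)
(* end-vertex. The values of [ends] outside [eset] are junk.                   *)
Record graph (T E : finType) := Graph {
  vset : {set T};
  eset : {set E};
  ends : E -> {set T};
  endsP : forall e, e \in eset -> (ends e \subset vset) && (0 < #|ends e| <= 2)
}.

Section Graphs.
Variables T E : finType.
Implicit Types (G : graph T E) (x y : T) (X C : {set E}) (K : {set T}).

Definition excess G : int := (#|eset G|%:Z - #|vset G|%:Z)%R.

Definition is_loop G (e : E) : bool := #|ends G e| == 1.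

Definition star G x : {set E} := [set e in eset G | x \in ends G e].

Definition stars G : {set {set E}} := [set star G x | x in vset G].

Definition degree G x : nat :=
  \sum_(e in star G x) (if is_loop G e then 2 else 1).

Definition isolated G x : bool := star G x == set0.

Definition leaf G x : bool := degree G x == 1.

Lemma edge_induced_proof G X e : e \in X :&: eset G ->
  (ends G e \subset \bigcup_(f in X :&: eset G) ends G f)
  && (0 < #|ends G e| <= 2).
Proof.
move=> eX; have /andP[_ ->] : (ends G e \subset vset G) && (0 < #|ends G e| <= 2).
  by apply: endsP; case/setIP: eX.
by rewrite andbT; apply: (bigcup_sup e).
Qed.

Definition edge_induced G X : graph T E :=
  Graph (@edge_induced_proof G X).

Lemma vertex_induced_proof G K e : e \in [set f in eset G | ends G f \subset K] ->
  (ends G e \subset vset G :&: K) && (0 < #|ends G e| <= 2).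
Proof.
by rewrite inE => /andP[/endsP/andP[sV ->] sK]; rewrite subsetI sV sK.
Qed.

Definition vertex_induced G K : graph T E :=
  Graph (@vertex_induced_proof G K).

Lemma del_vertex_proof G x e : e \in eset G :\: star G x ->
  (ends G e \subset vset G :\ x) && (0 < #|ends G e| <= 2).
Proof.
rewrite !inE => /andP[nx eG]; have /andP[sV ->] := endsP eG.
by rewrite eG /= in nx; rewrite subsetD1 sV nx.
Qed.

Definition del_vertex G x : graph T E :=
  Graph (@del_vertex_proof G x).

Definition adjacent G : rel T :=
  [rel x y | [exists e in eset G, (x \in ends G e) && (y \in ends G e)]].

Definition connected G : bool :=
  (vset G != set0) &&
  [forall x in vset G, forall y in vset G, connect (adjacent G) x y].

(* The vertex sets of the components of G. *)
Definition components G : {set {set T}} :=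
  equivalence_partition (connect (adjacent G)) (vset G).

(* Since a loop counts twice in the degree, a vertex with a single loop and a  *)
(* pair of parallel edges are cycles.                                          *)
Definition is_cycle G : bool :=
  connected G && [forall x in vset G, degree G x == 2].

Definition is_tree G : bool :=
  connected G &&
  [forall X : {set E}, (X \subset eset G) ==> ~~ is_cycle (edge_induced G X)].

Definition has_tree_component G : bool :=
  [exists K in components G, is_tree (vertex_induced G K)].

Definition in_Gbow G : bool :=
  [&& [forall x in vset G, ~~ isolated G x],
      [forall x in vset G, ~~ leaf G x] &
      [forall K in components G, ~~ is_cycle (vertex_induced G K)]].

Definition in_CGbow G : bool := connected G && in_Gbow G.

End Graphs.

(* A matroid given by its ground set and its family of circuits. *)
Record circuit_system (E : finType) := CircuitSystem {
  ground : {set E};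
  circuits : {set {set E}}
}.

Definition independent (E : finType) (M : circuit_system E) (X : {set E}) : bool :=
  (X \subset ground M) && [forall C in circuits M, ~~ (C \subset X)].

Definition rank (E : finType) (M : circuit_system E) : nat :=
  \max_(X : {set E} | independent M X) #|X|.

Definition corank (E : finType) (M : circuit_system E) : nat :=
  #|ground M| - rank M.

Definition M1 (T E : finType) (G : graph T E) : circuit_system E :=
  CircuitSystem (eset G)
    [set C : {set E} | [&& C \subset eset G,
                           excess (edge_induced G C) == 1%R &
                           in_Gbow (edge_induced G C)]].

Definition one_big (T E : finType) (G : graph T E) (x : T) : bool :=
  corank (M1 G) + 1 < #|star G x|.

Definition strongly_isomorphic (T T' E : finType)
    (G : graph T E) (G' : graph T' E) : Prop :=
  eset G = eset G' /\
  exists nu : {x | x \in vset G} -> {x' | x' \in vset G'},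
    bijective nu /\
    forall (e : E) (x y : {x | x \in vset G}), e \in eset G ->
      ends G e = [set val x; val y] <->
      ends G' e = [set val (nu x); val (nu y)].

(* Main.v *)
(* A set of edges is independent in M1(G) iff each of its subsets X spans at   *)
(* least #|X| vertices, so the rank of X is the minimum over Z of #|X :\: Z| + *)
(* #|verts G Z|. For a vertex x <> v, G \ x is connected with minimum degree 2 *)
(* and positive excess, so by Hall's condition its edge set H has rank |V| - 1 *)
(* and no coloop. In G' the absence of coloops forces Z = H in the rank        *)
(* formula, so H spans exactly |V'| - 1 vertices there, and adding any edge of *)
(* the star of x raises the rank, hence must reach the missing vertex x': the  *)
(* star of x in G is the star of x' in G'. For v, the absence of tree          *)
(* components still gives rank |V| - 1, and the vertex v' of G' not matched to *)
(* any x <> v is missed by all edges outside the star of v, as these are not   *)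
(* loops and have both ends matched.                                           *)

Require Import Defs.
From mathcomp Require Import all_boot all_order all_algebra.
From mathcomp Require Import zify.

Set Implicit Arguments.
Unset Strict Implicit.
Unset Printing Implicit Defensive.

(** Stars are recovered from ranks. Hall's condition turns local information on the graph into lower
    bounds on rank: [touching_gt] gives a strict surplus when degrees are at least 2 and the excess
    is positive, [touching_no_tree] the plain condition when every component contains a cycle.
    Through [sparse_minmax] and [independentE] these bounds are statements about the matroid, so
    [rank_ge_M1] carries them to [G'].

    In [G'] they become counts of vertices. If a set has rank exactly [n] and keeps it after the
    loss of any one edge, it spans exactly [n] vertices ([card_verts]). Applied to all edges this
    gives [G'] as many vertices as [G]; applied to the edges off a vertex [x] other than [v], it
    leaves a single vertex of [G'] uncovered, and [star_M1] shows that the two stars agree.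

    The edges off [v] may contain coloops, so [card_verts] does not apply to them. The vertices
    other than [v] are matched already, and an edge off [v] has two distinct matched ends, which
    leave no room for a third; the remaining vertex of [G'] is therefore uncovered, and [star_M1]
    applies again. Distinct vertices of [G] have distinct stars, so equal stars yield the
    isomorphism. *)

Section Counting.
Variables T E : finType.
Implicit Types (G : graph T E) (X Y Z I : {set E}) (W K : {set T}).

(** * Sparse sets and the rank formula *)

Definition verts G X : {set T} := \bigcup_(e in X) ends G e.

Definition sparse G X : bool :=
  [forall Y : {set E}, (Y \subset X) ==> (#|Y| <= #|verts G Y|)].

(** This is the minimum side of the rank formula; [sparse_minmax] equates it with the existence of a
    sparse subset of size at least [n]. *)
Definition rank_ge G n X : Prop :=
  forall Z, Z \subset X -> n <= #|X :\: Z| + #|verts G Z|.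

Definition touching G X W : {set E} :=
  [set e in X | ~~ [disjoint ends G e & W]].

Lemma vertsP G X x :
  reflect (exists2 e, e \in X & x \in ends G e) (x \in verts G X).
Proof. by apply: (iffP bigcupP) => -[e]; exists e. Qed.

Lemma sparseP G X :
  reflect (forall Y, Y \subset X -> #|Y| <= #|verts G Y|) (sparse G X).
Proof. exact: 'forall_implyP. Qed.

Lemma vertsS G X Y : X \subset Y -> verts G X \subset verts G Y.
Proof.
move=> sXY; apply/subsetP=> x /vertsP[e eX xe].
by apply/vertsP; exists e => //; apply: (subsetP sXY).
Qed.

Lemma vertsU G X Y : verts G (X :|: Y) = verts G X :|: verts G Y.
Proof. exact: bigcup_setU. Qed.

Lemma verts1 G e : verts G [set e] = ends G e.
Proof. exact: big_set1. Qed.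

Lemma verts_sub G X : X \subset eset G -> verts G X \subset vset G.
Proof.
move=> sX; apply/subsetP=> x /vertsP[e eX xe].
by have /andP[/subsetP->] := endsP (subsetP sX _ eX).
Qed.

Lemma touchingP G X W e :
  reflect (e \in X /\ exists2 x, x \in ends G e & x \in W)
          (e \in touching G X W).
Proof.
rewrite inE; apply: (iffP andP) => -[eX].
  by rewrite disjoint_subset => /subsetPn[x xe]; rewrite !inE negbK; split=> //; exists x.
by case=> x xe xW; split=> //; apply/pred0Pn; exists x; rewrite /= xe.
Qed.

Lemma touching_sub G X W : touching G X W \subset X.
Proof. by apply/subsetP=> e /touchingP[]. Qed.

Lemma verts_untouched G X W :
  verts G (X :\: touching G X W) \subset verts G X :\: W.
Proof.
apply/subsetP=> x /vertsP[e /setDP[eX neW] xe].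
rewrite inE; apply/andP; split; last by apply/vertsP; exists e.
by apply: contra neW => xW; apply/touchingP; split=> //; exists x.
Qed.

(** Submodularity of the number of spanned vertices. *)
Lemma card_vertsUI G X Y :
  #|verts G (X :|: Y)| + #|verts G (X :&: Y)| <= #|verts G X| + #|verts G Y|.
Proof.
rewrite -(cardsUI (verts G X)) vertsU leq_add2l; apply: subset_leq_card.
by rewrite subsetI !vertsS ?subsetIl ?subsetIr.
Qed.

Definition tight G I Y : bool := (Y \subset I) && (#|Y| == #|verts G Y|).

(** Uncrossing: sparsity bounds the sizes of union and intersection, and submodularity leaves no
    slack in either bound. *)
Lemma tightU G I Y Z :
  sparse G I -> tight G I Y -> tight G I Z -> tight G I (Y :|: Z).
Proof.
move=> /sparseP spI /andP[sY /eqP cY] /andP[sZ /eqP cZ].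
have sYZ : Y :|: Z \subset I by rewrite subUset sY.
have sYZ' : Y :&: Z \subset I by rewrite subIset ?sY.
rewrite /tight sYZ eqn_leq spI //=.
have := card_vertsUI G Y Z; have := cardsUI Y Z; have := spI _ sYZ'; lia.
Qed.

(* The tight subsets of a maximal sparse [I] have a largest member [S], which   *)
(* absorbs the ends of all edges of [X :\: I]: the minimum over [Z] is attained *)
(* at [S :|: (X :\: I)].                                                        *)
Lemma sparse_minmax G X n :
  (exists I, [/\ I \subset X, sparse G I & n <= #|I|]) <-> rank_ge G n X.
Proof.
split=> [[I [sIX /sparseP spI nI]] Z sZX|rkX].
  apply: leq_trans nI _; rewrite -(cardsID Z) addnC leq_add //.
    by apply/subset_leq_card/setSD.
  by apply: leq_trans (spI _ (subsetIl _ _)) _; apply/subset_leq_card/vertsS/subsetIr.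
have sp0 : (set0 \subset X) && sparse G set0.
  rewrite sub0set; apply/sparseP=> Y; rewrite subset0 => /eqP->; by rewrite cards0.
have [I /maxsetP[/andP[sIX spI] maxI] _] :=
  maxset_exists (P := fun I => (I \subset X) && sparse G I) sp0.
have t0 : tight G I set0.
  by rewrite /tight sub0set /verts big_set0 !cards0.
have [S /maxsetP[tS maxS] _] := maxset_exists t0.
have sSI : S \subset I by case/andP: tS.
have cS : #|S| = #|verts G S| by case/andP: tS => _ /eqP.
have absorb Y : tight G I Y -> verts G Y \subset verts G S.
  move=> tY; apply: vertsS; rewrite -(maxS (Y :|: S)) ?subsetUl ?subsetUr //.
  exact: tightU.
have spanned e : e \in X :\: I -> ends G e \subset verts G S.
  case/setDP=> eX neI.
  have : ~~ sparse G (e |: I).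
    apply: contra neI => spe; rewrite -(maxI (e |: I)) ?setU11 ?subsetUr //.
    by rewrite subUset sub1set eX sIX.
  (* A violating [Y] contains [e], and [Y :\ e] is squeezed between its own bound and that of [Y]:
     it is tight and spans the same vertices as [Y], among them the ends of [e]. *)
  rewrite negb_forall => /existsP[Y]; rewrite negb_imply -ltnNge => /andP[sY ltY].
  have sYI : Y :\ e \subset I by rewrite subDset.
  have leY := sparseP _ _ spI _ sYI.
  have eY : e \in Y.
    apply: contraLR ltY => neY; rewrite -leqNgt.
    apply: (sparseP _ _ spI); apply/subsetP=> f fY.
    by move: (subsetP sY f fY); rewrite !inE; case: eqP => // fe; rewrite -fe fY in neY.
  have vY : verts G (Y :\ e) \subset verts G Y by apply/vertsS/subD1set.
  have := subset_leq_card vY; rewrite (cardsD1 e Y) eY /= add1n ltnS in ltY => le2.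
  have tY : tight G I (Y :\ e) by rewrite /tight sYI eqn_leq leY (leq_trans le2).
  have vE : verts G (Y :\ e) = verts G Y by apply/eqP; rewrite eqEcard vY (leq_trans ltY).
  apply: subset_trans (absorb _ tY); rewrite vE.
  by apply/subsetP=> x xe; apply/vertsP; exists e.
exists I; split=> //; have := rkX (S :|: (X :\: I)).
rewrite subUset (subset_trans sSI sIX) subsetDl => /(_ isT) /leq_trans; apply.
have -> : verts G (S :|: (X :\: I)) = verts G S.
  rewrite vertsU; apply/setUidPl/subsetP=> x /vertsP[e eXI].
  exact: (subsetP (spanned e eXI)).
have -> : X :\: (S :|: (X :\: I)) = I :\: S.
  apply/setP=> f; rewrite !inE; have := subsetP sIX f.
  by case: (f \in S); case: (f \in I); case: (f \in X) => //= ->.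
by rewrite -cS addnC -{1}(setIidPr sSI) cardsID.
Qed.

(** The vertices of [W] missed by [Z] are touched only by edges outside [Z], so Hall's condition on
    them bounds their number by that of [X :\: Z]. *)
Lemma rank_ge_hall G X W :
  (forall U : {set T}, U \subset W -> #|U| <= #|touching G X U|) -> rank_ge G #|W| X.
Proof.
move=> hallX Z sZX; rewrite -(cardsID (verts G Z)) addnC leq_add //; last first.
  by apply/subset_leq_card/subsetIr.
apply: leq_trans (hallX _ (subsetDl _ _)) _; apply: subset_leq_card.
apply/subsetP=> e /touchingP[eX [x xe]]; rewrite !inE => /andP[nx _].
by rewrite eX andbT; apply: contra nx => eZ; apply/vertsP; exists e.
Qed.

(** If [Z] omits [e], then [e] adds one to the complement of [Z]; if [Z] contains [e], then [x] is a
    new spanned vertex, since no other edge of [Z] reaches it. *)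
Lemma rank_ge_star G x e n :
  rank_ge G n (eset G :\: star G x) -> e \in star G x ->
  rank_ge G n.+1 (e |: (eset G :\: star G x)).
Proof.
set H := eset G :\: star G x => rkH ex Z sZ.
have neH : e \notin H by rewrite inE ex.
have [eG xe] : e \in eset G /\ x \in ends G e by move: ex; rewrite inE => /andP[].
case: (boolP (e \in Z)) => eZ; last first.
  have sZH : Z \subset H.
    apply/subsetP=> f fZ; move: (subsetP sZ f fZ); rewrite in_setU1.
    by case: eqP => // fe; rewrite -fe fZ in eZ.
  have -> : (e |: H) :\: Z = e |: (H :\: Z).
    by rewrite setDUl; congr (_ :|: _); apply/setDidPl; rewrite disjoints1.
  by rewrite cardsU1 !inE (negbTE eZ) eG xe /= add1n addSn ltnS rkH.
have sZH : Z :\ e \subset H by rewrite subDset.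
have -> : (e |: H) :\: Z = H :\: (Z :\ e).
  apply/setP=> f; rewrite !inE; case: eqP => [->|] //=; by rewrite eZ eG xe.
have := rkH _ sZH; set V0 := verts G _ => le0.
have nx : x \notin V0.
  apply/vertsP=> -[f fZ xf]; move: (subsetP sZH f fZ).
  by rewrite !inE xf andbT; case: (f \in eset G).
have : #|x |: V0| <= #|verts G Z|.
  apply: subset_leq_card; rewrite subUset vertsS ?subD1set // sub1set andbT.
  by apply/vertsP; exists e.
rewrite cardsU1 nx; lia.
Qed.

(** * Degree sums and the strict Hall condition *)

(** The contribution of [e] to the degree sum over [W]; the weight of loops makes it exactly 2 for
    every edge with all ends in [W]. *)
Definition incidence G W e : nat :=
  #|ends G e :&: W| * (if is_loop G e then 2 else 1).

Lemma sum_degree G W :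
  \sum_(x in W) degree G x = \sum_(e in eset G) incidence G W e.
Proof.
rewrite /degree (exchange_big_dep (mem (eset G))) /=; last first.
  by move=> x e _; rewrite inE => /andP[].
apply: eq_bigr => e eG; rewrite /incidence -sum_nat_const.
by apply: eq_bigl => x; rewrite !inE eG andbC.
Qed.

Lemma ends_gt0 G e : e \in eset G -> 0 < #|ends G e|.
Proof. by move=> /endsP/and3P[]. Qed.

Lemma incidence_full G W e :
  e \in eset G -> ends G e \subset W -> incidence G W e = 2.
Proof.
move=> eG /setIidPl; rewrite /incidence => ->; move: (endsP eG) => /andP[_].
by rewrite /is_loop; case: #|_| => [|[|[|n]]].
Qed.

Lemma incidence_le G W e : e \in eset G ->
  incidence G W e <= (if e \in touching G (eset G) W then 2 else 0).
Proof.
move=> eG; rewrite inE eG /= -setI_eq0 -cards_eq0; case: eqP => [e0|_] /=.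
  by rewrite /incidence e0.
rewrite -(incidence_full eG (subxx _)) /incidence setIid leq_mul2r.
by rewrite subset_leq_card ?orbT // subsetIl.
Qed.

Lemma incidence_crossing G W e x :
  e \in eset G -> x \in ends G e -> x \notin W -> incidence G W e < 2.
Proof.
move=> eG xe xW; rewrite -(incidence_full eG (subxx _)) /incidence setIid ltn_mul2r.
apply/andP; split; first by case: ifP.
apply: proper_card; rewrite properEneq subsetIl andbT; apply: contra xW => /eqP eW.
by move: xe; rewrite -eW => /setIP[].
Qed.

Lemma sum_touching G W (c : nat) :
  \sum_(e in eset G) (if e \in touching G (eset G) W then c else 0)
    = c * #|touching G (eset G) W|.
Proof.
rewrite -big_mkcondr mulnC -sum_nat_const; apply: eq_bigl => e /=.
by rewrite !inE; case: (e \in eset G).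
Qed.

(** Each edge touching [W] contributes at most 2, and the edge [e] leaving [W] strictly less. *)
Lemma sum_degree_lt G W e x y :
    e \in eset G -> x \in ends G e -> y \in ends G e -> x \in W -> y \notin W ->
  \sum_(z in W) degree G z < 2 * #|touching G (eset G) W|.
Proof.
move=> eG xe ye xW yW; rewrite sum_degree -sum_touching.
rewrite (bigD1 e) //= [ltnRHS](bigD1 e) //= -addSn leq_add //.
  have -> : e \in touching G (eset G) W by apply/touchingP; split; last exists x.
  exact: incidence_crossing yW.
by apply: leq_sum => f /andP[/incidence_le].
Qed.

Lemma handshake G : \sum_(x in vset G) degree G x = 2 * #|eset G|.
Proof.
rewrite sum_degree mulnC -sum_nat_const; apply: eq_bigr => e eG.
by apply: incidence_full => //; case/andP: (endsP eG).
Qed.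

Lemma degree_ge2 G x : ~~ isolated G x -> ~~ leaf G x -> 1 < degree G x.
Proof.
rewrite /isolated /leaf => /set0Pn[e ex].
suff : 0 < degree G x by case: (degree G x) => [|[|]].
by rewrite /degree (bigD1 e) //=; case: ifP.
Qed.

Lemma card_cycle G : is_cycle G -> #|eset G| = #|vset G|.
Proof.
case/andP=> _ /'forall_implyP deg2; apply: double_inj.
rewrite -!muln2 mulnC -handshake -sum_nat_const; apply: eq_bigr => x xG.
exact/eqP/deg2.
Qed.

Lemma connect_closed G W x y :
    (forall e z, e \in eset G -> z \in ends G e -> z \in W -> ends G e \subset W) ->
  x \in W -> connect (adjacent G) x y -> y \in W.
Proof.
move=> clW xW /connectP[p]; elim: p x xW => [|z p IHp] x xW /=; first by move=> _ ->.
case/andP=> /existsP[e /and3P[eG xe ze]] pp lp; apply: (IHp z) => //.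
exact: (subsetP (clW e x eG xe xW)).
Qed.

(** Otherwise [W] would be closed under adjacency and hence contain every vertex. *)
Lemma connected_crossing G W :
    connected G -> W \subset vset G -> W != set0 -> W != vset G ->
  exists e x y, [/\ e \in eset G, x \in ends G e, y \in ends G e, x \in W & y \notin W].
Proof.
case/andP=> _ /forall_inP conG sW /set0Pn[x xW] nW.
have [y yG nyW] : exists2 y, y \in vset G & y \notin W.
  by apply/subsetPn; apply: contra nW => sGW; rewrite eqEsubset sW.
have cxy : connect (adjacent G) x y.
  by have /forall_inP := conG x (subsetP sW x xW); apply.
case: (boolP [exists e in touching G (eset G) W, ~~ (ends G e \subset W)]).
  case/exists_inP=> e /touchingP[eG [z ze zW]] /subsetPn[t te tW].
  by exists e, z, t.
rewrite negb_exists_in => /forall_inP clW.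
have : y \in W; last by rewrite (negbTE nyW).
apply: (connect_closed _ xW cxy) => e z eG ze zW.
by rewrite -[_ \subset _]negbK clW //; apply/touchingP; split=> //; exists z.
Qed.

(** For [W] the whole vertex set this is the positive excess. For a proper subset, minimum degree 2
    bounds the degree sum below by [2 * #|W|], and a crossing edge makes the upper bound strict. *)
Lemma touching_gt G W :
    (1 <= excess G)%R -> in_CGbow G -> W \subset vset G -> W != set0 ->
  #|W| < #|touching G (eset G) W|.
Proof.
rewrite /excess => ex1 /andP[conG /and3P[/forall_inP iso /forall_inP lf _]] sW W0.
have [->|nW] := eqVneq W (vset G).
  have -> : touching G (eset G) (vset G) = eset G.
    apply/setP=> e; rewrite inE; case eG: (e \in eset G) => //=.
    have /andP[sV /andP[e0 _]] := endsP eG.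
    by rewrite -setI_eq0 (setIidPl sV) -card_gt0.
  lia.
have [e [x [y [eG xe ye xW yW]]]] := connected_crossing conG sW W0 nW.
rewrite -(ltn_pmul2l (isT : 0 < 2)).
apply: leq_ltn_trans (sum_degree_lt eG xe ye xW yW).
rewrite mulnC -sum_nat_const; apply: leq_sum => z zW.
have zG := subsetP sW z zW; by apply: degree_ge2; [apply: iso|apply: lf].
Qed.

Lemma touchingD1 G X W e :
  #|touching G X W| <= #|touching G (X :\ e) W|.+1.
Proof.
rewrite (cardsD1 e) -add1n leq_add ?leq_b1 //; apply: subset_leq_card.
by apply/subsetP=> f; rewrite !inE => /and3P[-> ->].
Qed.

(** The surplus of one in [touching_gt] pays for the deleted edge; so no edge is a coloop. *)
Lemma rank_geD1 G e : (1 <= excess G)%R -> in_CGbow G ->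
  rank_ge G #|vset G| (eset G :\ e).
Proof.
move=> ex1 bG; apply: rank_ge_hall => W sW; rewrite -ltnS.
have [->|W0] := eqVneq W set0; first by rewrite cards0.
exact: leq_trans (touching_gt ex1 bG sW W0) (touchingD1 _ _ _ _).
Qed.

Lemma rank_geS G n X Y : X \subset Y -> rank_ge G n X -> rank_ge G n Y.
Proof.
move=> sXY /sparse_minmax[I [sI spI nI]]; apply/sparse_minmax.
by exists I; split=> //; apply: subset_trans sXY.
Qed.

(** * Components, and Hall's condition without tree components *)

Lemma touching_crossing G X W e x y :
    e \in X -> x \in ends G e -> x \in W -> y \in ends G e -> y \notin W ->
  #|ends G e| <= 2 -> #|touching G X (W :\ x)| < #|touching G X W|.
Proof.
move=> eX xe xW ye yW le2.
have nxy : x != y by apply: contraNneq yW => <-.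
have ee : ends G e = [set x; y].
  apply/esym/eqP; rewrite eqEcard cards2 nxy le2 andbT.
  by apply/subsetP=> z; rewrite !inE => /orP[]/eqP->.
apply: proper_card; apply/properP; split.
  apply/subsetP=> f /touchingP[fX [z zf /setD1P[_ zW]]].
  by apply/touchingP; split=> //; exists z.
exists e; first by apply/touchingP; split=> //; exists x.
apply/negP=> /touchingP[_ [z]]; rewrite ee !inE => /orP[]/eqP-> //.
  by rewrite eqxx.
by rewrite (negbTE yW) andbF.
Qed.

Lemma adjacent_sym G : symmetric (adjacent G).
Proof. by move=> x y; apply: eq_existsb => e; rewrite [(x \in _) && _]andbC. Qed.

Lemma adjacent_connect_sym G : connect_sym (adjacent G).
Proof. exact/sym_connect_sym/adjacent_sym. Qed.

Lemma componentsP G K : K \in components G ->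
  exists2 x, x \in vset G & K = [set y in vset G | connect (adjacent G) x y].
Proof. by case/imsetP=> x xG ->; exists x. Qed.

Lemma component_closed G K e z :
    K \in components G -> e \in eset G -> z \in ends G e -> z \in K ->
  ends G e \subset K.
Proof.
case/componentsP=> x _ -> eG ze; rewrite inE => /andP[zG cxz].
apply/subsetP=> t te; rewrite inE; have /andP[/subsetP-> //= _] := endsP eG.
apply: connect_trans cxz _; apply: connect1; apply/existsP; exists e.
by rewrite eG ze.
Qed.

Lemma component_neq0 G K : K \in components G -> (K != set0) && (K \subset vset G).
Proof.
case/componentsP=> x xG ->; apply/andP; split.
  by apply/set0Pn; exists x; rewrite inE xG connect0.
by apply/subsetP=> y; rewrite inE => /andP[].
Qed.

Lemma connected_component G K : K \in components G -> connected (vertex_induced G K).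
Proof.
move=> KG; have /andP[K0 sK] := component_neq0 KG.
rewrite /connected /= (setIidPr sK) K0; apply/forall_inP=> y yK; apply/forall_inP=> z zK.
have cyz : connect (adjacent G) y z.
  case/componentsP: KG yK zK => x _ ->; rewrite !inE => /andP[_ cxy] /andP[_].
  by rewrite (same_connect (@adjacent_connect_sym G) cxy).
case/connectP: cyz zK => p; elim: p y yK => [|t p IHp] y yK /=; first by move=> _ ->.
case/andP=> /existsP[e /and3P[eG ye te]] pp lz zK.
have sKe := component_closed KG eG ye yK.
apply: connect_trans (IHp t (subsetP sKe t te) pp lz zK).
by apply: connect1; apply/existsP; exists e; rewrite inE eG sKe ye.
Qed.

Lemma verts_cycle G X : is_cycle (edge_induced G X) ->
  #|X :&: eset G| = #|verts G (X :&: eset G)| /\ verts G (X :&: eset G) != set0.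
Proof. by move=> cyc; split; [exact: card_cycle cyc|case/andP: cyc => /andP[]]. Qed.

(** Induction on the size of [W]. If an edge leaves [W], removing its end in [W] loses that edge.
    Otherwise [W] contains a whole component, which has a cycle; the cycle has as many edges as
    vertices, and both can be removed. *)
Lemma touching_no_tree G W : ~~ has_tree_component G -> W \subset vset G ->
  #|W| <= #|touching G (eset G) W|.
Proof.
move=> noT; have [n] := ubnP #|W|; elim: n W => // n IHn W ltW sW.
have [->|/set0Pn[w wW]] := eqVneq W set0; first by rewrite cards0.
case: (boolP [exists e in touching G (eset G) W, ~~ (ends G e \subset W)]).
  case/exists_inP=> e /touchingP[eG [x xe xW]] /subsetPn[y ye yW].
  have /andP[_ /andP[_ le2]] := endsP eG.
  apply: leq_trans (touching_crossing eG xe xW ye yW le2).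
  rewrite (cardsD1 x) xW add1n ltnS in ltW *; apply: IHn => //.
  exact: subset_trans (subD1set _ _) sW.
rewrite negb_exists_in => /forall_inP clW.
have closedW e z : e \in eset G -> z \in ends G e -> z \in W -> ends G e \subset W.
  by move=> eG ze zW; rewrite -[_ \subset _]negbK clW //; apply/touchingP; split=> //; exists z.
pose K := [set y in vset G | connect (adjacent G) w y].
have KG : K \in components G by apply: imset_f; apply: (subsetP sW).
have sKW : K \subset W.
  by apply/subsetP=> y; rewrite inE => /andP[_]; apply: connect_closed wW.
move/exists_inPn: noT => /(_ K KG); rewrite /is_tree connected_component //=.
rewrite negb_forall => /existsP[X]; rewrite negb_imply negbK => /andP[_ /verts_cycle[]].
(* Passing to [vertex_induced] does not change [ends], so the vertices of the cycle [F] may be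
   computed in [G]. *)
set F := X :&: _; rewrite [verts _ F]/(verts G F) => cF F0.
have sFG : F \subset eset G.
  by apply/subsetP=> e; rewrite !inE => /and3P[].
have sVK : verts G F \subset K.
  apply/subsetP=> y /vertsP[e]; rewrite !inE => /and3P[_ _ sK] ye.
  by have := subsetP sK y ye; rewrite inE.
have sVW := subset_trans sVK sKW.
have sWV : W :\: verts G F \subset vset G by apply: subset_trans sW; apply: subsetDl.
have cW := cardsID (verts G F) W; rewrite (setIidPr sVW) -cF in cW.
have F_gt0 : 0 < #|F| by rewrite cF card_gt0.
have := IHn (W :\: verts G F) _ sWV.
set t := touching _ _ (W :\: _) => /(_ _)leW.
rewrite -cW; apply: leq_trans (_ : #|F :|: t| <= _).
  (* Edges of the cycle have all their ends among its own vertices, so the induction hypothesis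
     never counts them. *)
  have disFt : F :&: t = set0.
    apply/setP=> e; rewrite in_set0; apply/negP=> /setIP[eF /touchingP[_ [x xe]]].
    by case/setDP=> _ /negP; apply; apply/vertsP; exists e.
  rewrite cardsU disFt cards0 subn0 leq_add2l; apply: leW.
  by rewrite -ltnS; apply: leq_trans ltW; rewrite ltnS -cW -addn1 addnC leq_add2r.
apply: subset_leq_card; rewrite subUset; apply/andP; split.
  apply/subsetP=> e eF; apply/touchingP; split; first exact: (subsetP sFG).
  have /card_gt0P[x xe] := ends_gt0 (subsetP sFG _ eF).
  by exists x => //; apply: (subsetP sVW); apply/vertsP; exists e.
apply/subsetP=> e /touchingP[eG [x xe /setDP[xW _]]].
by apply/touchingP; split=> //; exists x.
Qed.

Lemma touching_component G K : K \in components G ->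
  touching G (eset G) K \subset eset (vertex_induced G K).
Proof.
move=> KG; apply/subsetP=> e /touchingP[eG [x xe xK]]; rewrite inE eG.
exact: component_closed xK.
Qed.

(** * Circuits as minimal dependent sets *)

Lemma circuit_dependent G (C : {set E}) : C \in circuits (M1 G) -> #|verts G C| < #|C|.
Proof.
rewrite inE => /and3P[sC /eqP + _]; rewrite /excess /= (setIidPl sC) -/(verts G C); lia.
Qed.

(** Deleting the edges that touch [W] leaves a proper subset, to which minimality applies; comparing
    counts gives [touch_gt]. Its case of a single vertex excludes isolated vertices and leaves, its
    case of a component excludes cycles. Deleting one edge bounds the excess by 1. *)
Lemma minimal_dependent_circuit G (C : {set E}) :
    C \subset eset G -> #|verts G C| < #|C| ->
    (forall Y : {set E}, Y \proper C -> #|Y| <= #|verts G Y|) ->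
  C \in circuits (M1 G).
Proof.
move=> sC depC minC; pose H := edge_induced G C.
have eH : eset H = C by rewrite /= (setIidPl sC).
have vH : vset H = verts G C by rewrite -eH.
have touch_gt W : W \subset verts G C -> W != set0 -> #|W| < #|touching G C W|.
  move=> sW /set0Pn[x xW]; pose Y := C :\: touching G C W.
  have pY : Y \proper C.
    have /vertsP[e eC xe] := subsetP sW x xW.
    apply/properP; split; first exact: subsetDl.
    exists e => //; rewrite in_setD eC andbT negbK.
    by apply/touchingP; split=> //; exists x.
  have := minC _ pY; have := subset_leq_card (verts_untouched G C W).
  have := cardsID (touching G C W) C; rewrite (setIidPr (touching_sub _ _ _)).
  have := cardsID W (verts G C); rewrite (setIidPr sW) -/Y; lia.
have Hdeg x : x \in vset H -> 1 < degree H x.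
  rewrite vH => xC; have := touch_gt [set x]; rewrite sub1set xC cards1.
  rewrite -card_gt0 cards1 => /(_ isT isT) /leq_trans; apply.
  rewrite /degree -sum1_card; have -> : touching G C [set x] = star H x.
    apply/setP=> e; rewrite [in RHS]inE eH; apply/touchingP/andP=> -[eC].
      by case=> y ye /set1P <-.
    by move=> xe; split=> //; exists x => //; apply: set11.
  by apply: leq_sum => e _; case: ifP.
rewrite inE sC /=; apply/and4P; split.
- rewrite /excess -/H eH vH; apply/eqP.
  have [x xC] : exists x, x \in C by apply/set0Pn; rewrite -card_gt0; lia.
  have := minC _ (properD1 xC); have := subset_leq_card (vertsS G (subD1set C x)).
  have := cardsD1 x C; rewrite xC; lia.
- apply/forall_inP=> x xH; apply: contraL (Hdeg x xH) => /eqP s0.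
  by rewrite /degree s0 big_set0.
- by apply/forall_inP=> x xH; apply: contraL (Hdeg x xH) => /eqP->.
apply/forall_inP=> K KH; apply/negP=> /card_cycle.
have /andP[K0 sK] := component_neq0 KH; rewrite /= -/H (setIidPr sK).
apply/eqP; rewrite neq_ltn; apply/orP; right.
have := touch_gt K; rewrite -vH => /(_ sK K0) /leq_trans; apply.
by have := subset_leq_card (touching_component KH); rewrite eH.
Qed.

Lemma independentE G X : independent (M1 G) X = (X \subset eset G) && sparse G X.
Proof.
rewrite /independent /=; case sX: (X \subset eset G) => //=.
apply/forall_inP/sparseP=> [indX Y sY|spX C CG]; last first.
  apply: contraL (circuit_dependent CG) => sCX; rewrite -leqNgt; exact: spX.
rewrite leqNgt; apply/negP=> depY.
have [C /minsetP[depC minC] sCY] :=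
  minset_exists (P := fun Y : {set E} => #|verts G Y| < #|Y|) depY.
have sCX := subset_trans sCY sY.
suff CG : C \in circuits (M1 G) by rewrite (negbTE (indX C CG)) in sCX.
apply: minimal_dependent_circuit depC _; first exact: subset_trans sCX sX.
move=> Z /andP[sZC nZC]; rewrite leqNgt; apply: contra nZC => depZ.
by rewrite (minC Z depZ sZC).
Qed.

(** * Spanned vertices from ranks, and vertex deletion *)

(** For [Z] other than [X], take an edge of [X] outside [Z]: the bound for [X] without this edge
    shows that [Z] gives at least [n.+1] in the formula. So the value [n] is attained only at
    [Z = X]. *)
Lemma card_verts G n X :
    rank_ge G n X -> ~ rank_ge G n.+1 X -> (forall e, e \in X -> rank_ge G n (X :\ e)) ->
  #|verts G X| = n.
Proof.
move=> rkX nrkX rkXe; apply/eqP; rewrite eqn_leq andbC; apply/andP; split.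
  by have := rkX X (subxx X); rewrite setDv cards0.
rewrite leqNgt; apply/negP=> ltn; apply: nrkX => Z sZX.
have [->|nZ] := eqVneq Z X; first by rewrite setDv cards0.
have /subsetPn[e eX eZ] : ~~ (X \subset Z).
  by apply: contra nZ => sXZ; rewrite eqEsubset sZX.
have sZ : Z \subset X :\ e by rewrite subsetD1 sZX eZ.
have := rkXe e eX Z sZ; rewrite (cardsD1 e (X :\: Z)) inE eX eZ /= -ltnS => /leq_trans; apply.
by rewrite -addnA add1n ltnS setDDl setUC -setDDl.
Qed.

Lemma verts_eset G : (forall x, x \in vset G -> ~~ isolated G x) ->
  verts G (eset G) = vset G.
Proof.
move=> iso; apply/eqP; rewrite eqEsubset verts_sub //=; apply/subsetP=> x xG.
have /set0Pn[e] := iso x xG; rewrite inE => /andP[eG xe].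
by apply/vertsP; exists e.
Qed.

Lemma verts_unstar G x : verts G (eset G :\: star G x) \subset vset G :\ x.
Proof. exact: (@verts_sub (del_vertex G x) _ (subxx _)). Qed.

(** This separates stars: a vertex [y] with the same star as [x] would become isolated once [x] is
    deleted. *)
Lemma star_del_vertex G x y : isolated (del_vertex G x) y = (star G y \subset star G x).
Proof.
rewrite /isolated -subset0; apply/subsetP/subsetP=> sub e.
  move=> ey; have [eG ye] : e \in eset G /\ y \in ends G e.
    by move: ey; rewrite inE => /andP[].
  case ex: (e \in star G x) => //; suff: e \in set0 by rewrite inE.
  by apply: sub; rewrite inE /= ye andbT inE ex.
case/setIdP=> /setDP[eG nex] ye.
by case/negP: nex; apply: sub; rewrite inE eG.
Qed.

End Counting.

(** * Two graphs with the same matroid *)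

Section SameMatroid.
Variables T T' E : finType.
Variables (G : graph T E) (G' : graph T' E).
Hypothesis eqM : M1 G' = M1 G.

Lemma eset_M1 : eset G' = eset G.
Proof. exact: (congr1 (@ground E) eqM). Qed.

Lemma rank_ge_M1 n (X : {set E}) : X \subset eset G -> rank_ge G n X <-> rank_ge G' n X.
Proof.
move=> sX; split=> /sparse_minmax[I [sI spI nI]]; apply/sparse_minmax; exists I; split=> //;
  have sIE := subset_trans sI sX.
  by have := independentE G' I; rewrite eqM independentE spI eset_M1 sIE /= => <-.
by have := independentE G I; rewrite -eqM independentE spI eset_M1 sIE /= => <-.
Qed.

(** An edge of [G'] at [x'] is not in the set avoiding [x'], so it lies in the star of [x].
    Conversely, an edge at [x] raises the rank to [m.+1], which forces all of [vset G'] to be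
    spanned, including [x']. *)
Lemma star_M1 m x x' :
    rank_ge G m (eset G :\: star G x) -> #|vset G'| = m.+1 -> x' \in vset G' ->
    x' \notin verts G' (eset G :\: star G x) ->
  star G x = star G' x'.
Proof.
set H := _ :\: _ => rkH cV x'G nx'H; apply/eqP; rewrite eqEsubset andbC; apply/andP; split.
  apply/subsetP=> e; rewrite inE eset_M1 => /andP[eG x'e].
  by apply: contraR nx'H => nex; apply/vertsP; exists e => //; rewrite inE nex.
apply/subsetP=> e ex; have eG : e \in eset G by move: ex; rewrite inE => /andP[].
rewrite inE eset_M1 eG; apply: contraT => nx'e.
have sU : e |: H \subset eset G by rewrite subUset sub1set eG subsetDl.
have := (rank_ge_M1 m.+1 sU).1 (rank_ge_star rkH ex) _ (subxx _).
rewrite setDv cards0 add0n ltnNge => /negP[].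
rewrite -[m]/(m.+1.-1) -cV (cardsD1 x' (vset G')) x'G.
apply: subset_leq_card; rewrite subsetD1 verts_sub ?eset_M1 //=.
by rewrite vertsU verts1 inE negb_or nx'e.
Qed.

Lemma star_M1_del m x :
    (forall x' : T', x' \in vset G' -> ~~ isolated G' x') ->
    #|vset G| = m.+1 -> #|vset G'| = m.+1 -> x \in vset G ->
    (1 <= excess (del_vertex G x))%R -> in_CGbow (del_vertex G x) ->
  exists2 x', x' \in vset G' & star G x = star G' x'.
Proof.
move=> iso cV cV' xG ex1 bD; set H := eset G :\: star G x.
have cD : #|vset G :\ x| = m by move: cV; rewrite (cardsD1 x) xG => -[].
have rkHe e : rank_ge G m (H :\ e) by rewrite -cD; exact: (rank_geD1 (G := del_vertex G x)).
have H0 : exists e, e \in H.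
  by apply/card_gt0P; move: ex1; rewrite /excess /= -/H; lia.
have sH : H \subset eset G by apply: subsetDl.
have rkH : rank_ge G m H by have [e eH] := H0; apply: rank_geS (rkHe e); apply: subD1set.
have cH : #|verts G' H| = m.
  apply: card_verts => [||e eH].
  - exact/rank_ge_M1.
  (* The rank cannot exceed [m], because in [G] these edges avoid [x]. *)
  - move/rank_ge_M1=> /(_ sH) /(_ H (subxx _)); rewrite setDv cards0 add0n ltnNge -cD.
    by rewrite subset_leq_card // verts_unstar.
  - by apply/rank_ge_M1 => //; apply: subset_trans (subD1set _ _) sH.
have [x' x'G nx'] : exists2 x', x' \in vset G' & x' \notin verts G' H.
  by apply/subsetPn; apply: contraL (ltnSn m) => /subset_leq_card; rewrite cV' cH -leqNgt.
by exists x' => //; exact: (star_M1 rkH cV' x'G nx').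
Qed.

(** Sending each vertex to one with the same star is injective because stars determine vertices of
    [G], hence bijective by counting; equal stars mean equal incidences, so ends correspond. *)
Lemma strongly_isomorphic_stars :
    {in vset G &, injective (star G)} -> #|vset G| = #|vset G'| ->
    (forall x, x \in vset G -> exists2 x', x' \in vset G' & star G x = star G' x') ->
  stars G = stars G' /\ strongly_isomorphic G G'.
Proof.
move=> injS cV exS.
have /fin_all_exists[nu nuS] (x : {x | x \in vset G}) :
    exists x' : {x' | x' \in vset G'}, star G (val x) = star G' (val x').
  by have [x' x'G eq] := exS _ (valP x); exists (Sub x' x'G).
have nu_inj : injective nu.
  by move=> x y eq; apply/val_inj/injS; rewrite ?nuS ?eq //; apply: valP.
have nu_bij : bijective nu by apply: inj_card_bij nu_inj _; rewrite !card_sig cV.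
have [mu _ muK] := nu_bij.
split.
  apply/setP=> S; apply/imsetP/imsetP=> -[x xG ->].
    by have [x' x'G ->] := exS x xG; exists x'.
  exists (val (mu (Sub x xG))); first exact: valP.
  by rewrite nuS muK.
split; first by rewrite eset_M1.
exists nu; split=> // e x y eG.
have nu_ends z : (val (nu z) \in ends G' e) = (val z \in ends G e).
  by have /setP/(_ e) := nuS z; rewrite !inE eset_M1 eG.
have nu_eq z t : (val (nu z) == val (nu t)) = (val z == val t).
  by rewrite !val_eqE (inj_eq nu_inj).
have sV : ends G e \subset vset G by case/andP: (endsP eG).
have sV' : ends G' e \subset vset G' by rewrite -eset_M1 in eG; case/andP: (endsP eG).
split=> /setP eq; apply/setP=> z; apply/idP/idP.
- move=> ze; have zG := subsetP sV' z ze.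
  (* Surjectivity lets [z] be written as an image under [nu], where incidence can be read in [G]. *)
  rewrite -[z]/(val (Sub z zG : {x' | x' \in vset G'})) -[Sub z zG]muK in ze *.
  by move: ze; rewrite nu_ends eq !inE !nu_eq.
- by case/set2P=> ->; rewrite nu_ends eq !inE eqxx ?orbT.
- move=> ze; have zG := subsetP sV z ze.
  rewrite -[z]/(val (Sub z zG : {x | x \in vset G})) in ze *.
  by move: ze; rewrite -nu_ends eq !inE !nu_eq.
by case/set2P=> ->; rewrite -nu_ends eq !inE eqxx ?orbT.
Qed.

End SameMatroid.

(* [hG'] is the standing convention that G' has no isolated vertices: these   *)
(* are invisible to M1, whereas [stars] and [strongly_isomorphic] see them.    *)
Theorem theorem6p4 (T T' E : finType) (G : graph T E) (G' : graph T' E) (v : T)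
    (hv : v \in vset G)
    (hG' : forall x' : T', x' \in vset G' -> ~~ isolated G' x')
    (a1 : (1 <= excess G)%R /\ in_CGbow G)
    (a2 : forall x : T, x \in vset G -> x <> v ->
            (1 <= excess (del_vertex G x))%R /\ in_CGbow (del_vertex G x))
    (a3 : forall p : E, p \in eset G -> is_loop G p -> p \in star G v)
    (a4 : ~~ one_big G v /\ ~~ has_tree_component (del_vertex G v))
    (a5 : M1 G' = M1 G) :
  stars G = stars G' /\ strongly_isomorphic G G'.
Proof.
case: a1 a4 => ex1 bG [_ noT].
have star_inj_ne x y : x \in vset G -> y \in vset G -> x <> v -> star G x = star G y -> x = y.
  move=> xG yG nxv eqS; apply/eqP; apply: contraT => nxy.
  have [_ /and3P[_ /forall_inP/(_ y)]] := a2 x xG nxv.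
  by rewrite !inE eq_sym nxy yG star_del_vertex eqS subxx => /(_ isT).
have star_inj : {in vset G &, injective (star G)}.
  move=> x y xG yG eqS; have [xv|/eqP nxv] := eqVneq x v; last exact: star_inj_ne.
  have [->|/eqP nyv] := eqVneq y v; first by [].
  exact/esym/star_inj_ne.
have [m cV] : exists m, #|vset G| = m.+1 by exists #|vset G|.-1; rewrite (cardsD1 v) hv.
(* All edges together have rank [#|vset G|] and no coloop, so in [G'] they span that many vertices,
   which are all of its vertices by [hG']. *)
have cV' : #|vset G'| = m.+1.
  have rkE e : rank_ge G m.+1 (eset G :\ e) by rewrite -cV; apply: rank_geD1.
  rewrite -(verts_eset hG') (eset_M1 a5); apply: card_verts => [||e eG].
  - apply/(rank_ge_M1 a5) => //.
    have /card_gt0P[e eG] : 0 < #|eset G| by move: ex1; rewrite /excess; lia.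
    exact: rank_geS (subD1set _ e) (rkE e).
  - move/(rank_ge_M1 a5)=> /(_ (subxx _)) /(_ _ (subxx _)).
    by rewrite setDv cards0 add0n ltnNge -cV subset_leq_card ?verts_sub.
  - exact/(rank_ge_M1 a5)/rkE/subD1set.
have exS x : x \in vset G -> x <> v -> exists2 x', x' \in vset G' & star G x = star G' x'.
  by move=> xG nxv; have [ex1x bx] := a2 x xG nxv; apply: (star_M1_del a5 hG' cV cV').
have [w' w'G] : exists w', w' \in vset G' by apply/card_gt0P; rewrite cV'.
(* The vertex [w'] is only a default value of [f] outside [vset G :\ v]. *)
have /fin_all_exists[f fS] x : exists x', x \in vset G :\ v ->
    x' \in vset G' /\ star G x = star G' x'.
  case: (boolP (x \in vset G :\ v)) => [/setD1P[/eqP nxv xG]|]; last by exists w'.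
  by have [x'] := exS x xG nxv; exists x'.
have f_inj : {in vset G :\ v &, injective f}.
  move=> x y xG yG eqf; have [_ Sx] := fS x xG; have [_ Sy] := fS y yG.
  apply: star_inj; [by case/setD1P: xG|by case/setD1P: yG|by rewrite Sx Sy eqf].
have cD : #|vset G :\ v| = m by move: cV; rewrite (cardsD1 v) hv => -[].
have [v' v'G nv'] : exists2 v', v' \in vset G' & v' \notin f @: (vset G :\ v).
  apply/subsetPn; apply: contraL (ltnSn m) => /subset_leq_card.
  by rewrite cV' card_in_imset // cD -leqNgt.
have rkv : rank_ge G m (eset G :\: star G v).
  rewrite -cD; apply: (@rank_ge_hall _ _ (del_vertex G v)) => W sW.
  exact: touching_no_tree.
(* An edge off [v] is no loop by [a3], so it has two ends other than [v]; their distinct images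
   under [f] are already all its ends in [G']. *)
have nv'H : v' \notin verts G' (eset G :\: star G v).
  apply: contra nv' => /vertsP[e eH v'e].
  have [eG nve] : e \in eset G /\ e \notin star G v by case/setDP: eH.
  have sV := @endsP _ _ (del_vertex G v) e eH; rewrite /= in sV; case/andP: sV => sV le2.
  have [x [y [nxy ee]]] : exists x y, x != y /\ ends G e = [set x; y].
    apply/cards2P.
    have := contra (a3 e eG) nve; rewrite /is_loop; case: #|_| le2 => [|[|[|]]] //.
  have [xD yD] : x \in vset G :\ v /\ y \in vset G :\ v.
    by move: sV; rewrite ee subUset !sub1set => /andP[].
  have f_ends z : z \in vset G :\ v -> z \in ends G e -> f z \in ends G' e.
    move=> zD ze; have [_ /setP/(_ e)] := fS z zD.
    by rewrite !inE eG ze /= => /esym/andP[].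
  have eG' : e \in eset G' by rewrite (eset_M1 a5).
  have /andP[_ /andP[_ le2']] := endsP eG'.
  have : ends G' e = [set f x; f y].
    apply/esym/eqP; rewrite eqEcard subUset !sub1set !f_ends ?ee ?set21 ?set22 //=.
    by rewrite cards2 (inj_in_eq f_inj) // nxy.
  by move=> ee'; move: v'e; rewrite ee' => /set2P[]->; apply: imset_f.
have Sv := star_M1 a5 rkv cV' v'G nv'H.
apply: strongly_isomorphic_stars => //; first by rewrite cV.
move=> x xG; have [->|/eqP nxv] := eqVneq x v; first by exists v'.
exact: exS.
Qed.
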